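(* For every integer $n\ge 5$, $$C_n\le 2n(n-1)(n-2)^{n-2}+2n+1,$$ where $C_n:=\sup_{A\in\mathcal{A}_n} C(A\cup B_{n-2,n},\mathcal{P}_n)$.
   Context: $\mathbb{E}^n$ denotes $n$-dimensional Euclidean space, with basic unit vectors $\boldsymbol{e}_1,\dots,\boldsymbol{e}_n$. For a set $A\subset\mathbb{E}^n$ and a family $\mathcal{B}$ of subsets of $\mathbb{E}^n$, $C(A,\mathcal{B})$ is the smallest number of translates of elements of $\mathcal{B}$ required to cover $A$ (different elements of $\mathcal{B}$ may be used). $B_{k,n}$ is the $k$-skeleton of the unit cube $[0,1]^n$, i.e. the union of all $k$-dimensional faces of $[0,1]^n$; equivalently, the set of all points of $[0,1]^n$ having at least $n-k$ coordinates equal to $0$ or $1$. $\mathcal{A}_n:=\left\{\bigcup_{i=1}^n\{\boldsymbol{x}_i,\boldsymbol{x}_i+\boldsymbol{e}_i\}:\ \boldsymbol{x}_i,\ \boldsymbol{x}_i+\boldsymbol{e}_i\in[0,1]^n \text{ for } i=1,\dots,n\right\}$; each element of $\mathcal{A}_n$ is a set of at most $2n$ points of the boundary of the cube. $\mathcal{P}_n:=\left\{\prod_{i=1}^n[x_i,x_i+\delta_i]:\ x_i\in\mathbb{R},\ \delta_i\ge 0,\ \sum_{i=1}^n\delta_i<1\right\}$, a family of axis-parallel boxes (degenerate sides $\delta_i=0$ are allowed). *)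

(* Defs.v *)
From HB Require Import structures.
From mathcomp Require Import all_boot all_order all_algebra.
From mathcomp Require Import all_classical all_reals ereal.

Set Implicit Arguments.
Unset Strict Implicit.
Unset Printing Implicit Defensive.

Import Order.TTheory GRing.Theory Num.Theory.

Local Open Scope classical_set_scope.
Local Open Scope ring_scope.

Definition translate (V : zmodType) (v : V) (S : set V) : set V :=
  [set x + v | x in S].

(* The [S i] need not be distinct, which does not affect the least such m. *)
Definition covered_by (V : zmodType) (A : set V) (B : set (set V)) (m : nat) :
    Prop :=
  exists S : 'I_m -> set V,
    (forall i, exists2 P, B P & exists v, S i = translate v P) /\
    A `<=` \bigcup_i S i.

(* Extended-real valued: +oo when no finite number of translates covers A;
   otherwise the infimum, over a nonempty set of naturals, is attained. *)
Definition covering_number (R : realType) (V : zmodType) (A : set V)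
    (B : set (set V)) : \bar R :=
  ereal_inf [set (m%:R : R)%:E | m in [set m | covered_by A B m]].

Definition unit_cube (R : realType) (n : nat) : set 'rV[R]_n :=
  [set x | forall i, 0 <= x 0 i <= 1].

(* The face of the cube with free coordinates in F, every other coordinate i
   being fixed to 0 or 1 according to b i; its dimension is #|F|. *)
Definition cube_face (R : realType) (n : nat) (F : {set 'I_n})
    (b : 'I_n -> bool) : set 'rV[R]_n :=
  [set x | unit_cube x /\ forall i, i \notin F -> x 0 i = (b i)%:R].

Definition skeleton (R : realType) (k n : nat) : set 'rV[R]_n :=
  [set x | exists (F : {set 'I_n}) (b : 'I_n -> bool),
     #|F| = k /\ cube_face F b x].

Definition unit_pairs (R : realType) (n : nat) : set (set 'rV[R]_n) :=
  [set A | exists2 x : 'I_n -> 'rV[R]_n,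
     forall i, unit_cube (x i) /\ unit_cube (x i + delta_mx 0 i) &
     A = \bigcup_i [set x i; x i + delta_mx 0 i]].

Definition short_boxes (R : realType) (n : nat) : set (set 'rV[R]_n) :=
  [set P | exists x d : 'rV[R]_n,
     [/\ forall i, 0 <= d 0 i,
         \sum_(i < n) d 0 i < 1 &
         P = [set y : 'rV[R]_n | forall i, x 0 i <= y 0 i <= x 0 i + d 0 i]]].

Definition sup_covering (R : realType) (n : nat) : \bar R :=
  ereal_sup [set covering_number R (A `|` @skeleton R (n - 2) n)
                                   (@short_boxes R n)
            | A in @unit_pairs R n].

(* Main.v *)
(** Let k = n - 2. A grid of k ^ k cubes of side 1/k covers a k-dimensional
    face, but their side sums are exactly 1. A finite family of boxes with side
    sums below 1 has slack, so it can be enlarged slightly in all directions.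
    Hence if the part already covered contains a facet G of a face F, it also
    covers a thin slab of F along G, and k ^ k boxes that are slightly shorter
    in the direction transverse to G suffice for the rest of F. The 2n(n - 1)
    faces are reached in turn through such facets. The first face is filled in
    the same way, starting from a single cube of side 1/k, which takes two boxes
    instead of one: this is the only extra box. The other 2n boxes are the
    points of A. *)
Require Import Defs.
From mathcomp Require Import all_boot all_order all_algebra.
From mathcomp Require Import all_classical all_reals ereal.
From mathcomp Require Import ring lra zify.

Import Order.TTheory GRing.Theory Num.Theory.

Local Open Scope ring_scope.

(** * Covers by boxes of side sum below 1 *)

Definition box (R : realType) (n : nat) (lo hi : 'I_n -> R) : set 'rV[R]_n :=
  [set x | forall i, lo i <= x 0 i <= hi i]%classic.

(** Boxes are recorded by their end points and no translation occurs, since [short_boxes] is closed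
    under translation. *)
Definition short_cover (R : realType) (n : nat) (X : set 'rV[R]_n)
    (N : nat) : Prop :=
  exists lo hi : 'I_N -> 'I_n -> R,
    (forall j, (forall i, lo j i <= hi j i) /\
               \sum_i (hi j i - lo j i) < 1) /\
    forall x, X x -> exists j, box R n (lo j) (hi j) x.

Lemma short_cover_fin (R : realType) (n : nat) (X : set 'rV[R]_n)
    (I : finType) (lo hi : I -> 'I_n -> R) :
  (forall j, (forall i, lo j i <= hi j i) /\ \sum_i (hi j i - lo j i) < 1) ->
  (forall x, X x -> exists j, box R n (lo j) (hi j) x) ->
  short_cover R n X #|I|.
Proof.
move=> short cov; exists (lo \o enum_val), (hi \o enum_val).
split=> [j|x /cov[j xj]]; first exact: short.
by exists (enum_rank j); rewrite /= enum_rankK.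
Qed.

Lemma short_cover_sub (R : realType) (n : nat) (X Y : set 'rV[R]_n) (N : nat) :
  (Y `<=` X)%classic -> short_cover R n X N -> short_cover R n Y N.
Proof.
by move=> YX [lo [hi [short cov]]]; exists lo, hi; split=> // x /YX/cov.
Qed.

Lemma short_coverU (R : realType) (n : nat) (X Y : set 'rV[R]_n) (M N : nat) :
  short_cover R n X M -> short_cover R n Y N ->
  short_cover R n (X `|` Y)%classic (M + N).
Proof.
move=> [lo1 [hi1 [short1 cov1]]] [lo2 [hi2 [short2 cov2]]].
pose lo (j : 'I_M + 'I_N) := match j with inl a => lo1 a | inr a => lo2 a end.
pose hi (j : 'I_M + 'I_N) := match j with inl a => hi1 a | inr a => hi2 a end.
have -> : (M + N = #|{: 'I_M + 'I_N}|)%N by rewrite card_sum !card_ord.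
apply: (short_cover_fin R n _ _ lo hi) => [[a|a]|x [/cov1[a xa]|/cov2[a xa]]].
- exact: short1.
- exact: short2.
- by exists (inl a).
- by exists (inr a).
Qed.

Lemma short_cover_points (R : realType) (n : nat) (I : finType)
    (x : I -> 'rV[R]_n) :
  short_cover R n (range x)%classic #|I|.
Proof.
apply: (short_cover_fin R n _ _ (fun j => x j 0) (fun j => x j 0)).
  by move=> j; split=> //; rewrite big1 // => i _; rewrite subrr.
by move=> _ [j _ <-]; exists j => i; rewrite lexx.
Qed.

(** * Slack of a finite cover *)

Definition thickening (R : realType) (n : nat) (X : set 'rV[R]_n) (e : R) :
    set 'rV[R]_n :=
  [set y | exists2 x, X x & forall i, `|y 0 i - x 0 i| <= e]%classic.

(** Finitely many strict inequalities leave a common positive slack, which is spent on moving all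
    sides of all boxes outwards by [e]. *)
Lemma short_cover_thicken (R : realType) (n : nat) (X : set 'rV[R]_n)
    (N : nat) :
  short_cover R n X N ->
  exists2 e : R, 0 < e & short_cover R n (thickening R n X e) N.
Proof.
move=> [lo [hi [short cov]]].
(* The initial value [1] gives a positive [d] even when there are no boxes. *)
pose d := \big[Num.min/1]_j (1 - \sum_i (hi j i - lo j i)).
have d_gt0 : 0 < d.
  by apply: lt_bigmin => // j _; rewrite subr_gt0; case: (short j).
have n_gt0 : 0 < (2 * n.+1)%:R :> R by rewrite ltr0n.
(* Moving both ends of [n] sides adds [2 * n * e]; the divisor [2 * n.+1] keeps this strictly below
   [d], also for [n = 0]. *)
pose e := d / (2 * n.+1)%:R.
have e_gt0 : 0 < e by rewrite divr_gt0.
have de : d = e * 2 * (n%:R + 1) by rewrite /e natrM -natr1; field; lra.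
have e_n : e * 2 * n%:R < d by rewrite de; nra.
exists e => //.
exists (fun j i => lo j i - e), (fun j i => hi j i + e); split=> [j|y].
  have [loj sumj] := short j; split=> [i|]; first by have := loj i; lra.
  have -> : \sum_i (hi j i + e - (lo j i - e)) =
            \sum_i (hi j i - lo j i) + e * 2 * n%:R.
    rewrite mulr_natr -[in e * 2 *+ n](card_ord n) -sumr_const -big_split /=.
    by apply: eq_bigr => i _; ring.
  have : d <= 1 - \sum_i (hi j i - lo j i) by exact: bigmin_le.
  lra.
move=> [x /cov[j xj] yx]; exists j => i.
by have := xj i; have := yx i; rewrite ler_norml; lra.
Qed.

(** * Grids, and extension across a facet *)

Lemma mesh_index (R : realType) (m : nat) (w t : R) :
  0 <= t <= m.+1%:R * w -> exists j : 'I_m.+1, j%:R * w <= t <= j.+1%:R * w.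
Proof.
elim: m => [|m IHm] /andP[t0 tm].
  by exists ord0; rewrite mul0r t0.
have [tle|tgt] := leP t (m.+1%:R * w).
  have [|j tj] := IHm; first by rewrite t0.
  by exists (widen_ord (leqnSn _) j).
by exists ord_max; rewrite /= tm ltW.
Qed.

Lemma short_cover_grid (R : realType) (n : nat) (lo hi : 'I_n -> R)
    (m : 'I_n -> nat) :
  (forall i, lo i <= hi i) -> (forall i, 0 < m i)%N ->
  \sum_i (hi i - lo i) / (m i)%:R < 1 ->
  short_cover R n (box R n lo hi) (\prod_i m i).
Proof.
move=> lohi m_gt0 short.
pose w i := (hi i - lo i) / (m i)%:R.
have w_ge0 i : 0 <= w i by rewrite divr_ge0 // subr_ge0.
have -> : (\prod_i m i = #|{dffun forall i : 'I_n, 'I_(m i)}|)%N.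
  rewrite card_dep_ffun foldrE big_image /=.
  by apply: eq_bigr => i _; rewrite card_ord.
apply: (short_cover_fin R n _ _
  (fun (f : {dffun forall i : 'I_n, 'I_(m i)}) i => lo i + (f i)%:R * w i)
  (fun (f : {dffun forall i : 'I_n, 'I_(m i)}) i => lo i + (f i).+1%:R * w i)).
  have width (f : {dffun forall i : 'I_n, 'I_(m i)}) i :
      lo i + (f i).+1%:R * w i - (lo i + (f i)%:R * w i) = w i.
    by rewrite -natr1; ring.
  move=> f; split=> [i|]; first by rewrite -subr_ge0 width.
  by under eq_bigr => i _ do rewrite width.
move=> x xbox.
have idx i : exists j : 'I_(m i),
    lo i + j%:R * w i <= x 0 i <= lo i + j.+1%:R * w i.
  have mi := m_gt0 i; have xi := xbox i.
  have mw : (m i)%:R * w i = hi i - lo i.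
    by rewrite /w mulrC divfK // pnatr_eq0 -lt0n.
  have tP : 0 <= x 0 i - lo i <= (m i)%:R * w i by rewrite mw; lra.
  move: mi tP; case: (m i) => // p _ /mesh_index[j jP].
  by exists j; lra.
exists [ffun i => sval (cid (idx i))] => i; rewrite ffunE.
exact: svalP (cid (idx i)).
Qed.

(** [c i] is the side allotted to a cell in direction [i]. A total of exactly 1 is allowed because
    direction [q] stays strictly below its allotment. *)
Lemma short_cover_grid_lt (R : realType) (n : nat) (lo hi c : 'I_n -> R)
    (m : 'I_n -> nat) (q : 'I_n) :
  (forall i, lo i <= hi i) -> (forall i, 0 < m i)%N ->
  (forall i, hi i - lo i <= (m i)%:R * c i) -> hi q - lo q < (m q)%:R * c q ->
  \sum_i c i <= 1 ->
  short_cover R n (box R n lo hi) (\prod_i m i).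
Proof.
move=> lohi m_gt0 side side_q sumc; apply: short_cover_grid => //.
have mR i : 0 < (m i)%:R :> R by rewrite ltr0n.
apply: lt_le_trans sumc; rewrite (bigD1 q) //= [ltRHS](bigD1 q) //=.
rewrite ltr_leD ?ltr_pdivrMr // 1?mulrC // ler_sum // => i _.
by rewrite ler_pdivrMr // mulrC.
Qed.

(** The thickened cover of [X] absorbs a slab along the facet where coordinate [q] equals [s]. The
    rest of the box is shorter in direction [q], which supplies the strict inequality for
    [short_cover_grid_lt]. *)
Lemma short_cover_step (R : realType) (n N : nat) (X : set 'rV[R]_n)
    (lo hi c : 'I_n -> R) (m : 'I_n -> nat) (q : 'I_n) (s : R) :
  short_cover R n X N ->
  (forall i, lo i <= hi i) -> (forall i, 0 < m i)%N ->
  (forall i, hi i - lo i <= (m i)%:R * c i) -> \sum_i c i <= 1 ->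
  lo q < hi q -> s = lo q \/ s = hi q ->
  (forall y, box R n lo hi y -> y 0 q = s -> X y) ->
  short_cover R n (X `|` box R n lo hi)%classic (N + \prod_i m i).
Proof.
move=> /short_cover_thicken[e e_gt0 covX] lohi m_gt0 side sumc lohi_q sE Xs.
(* Capping by the side length keeps the trimmed box nonempty. *)
pose e' := Num.min e (hi q - lo q).
have e'_gt0 : 0 < e' by rewrite lt_min e_gt0 subr_gt0.
have e'_le : e' <= e by by rewrite ge_min lexx.
have e'_hi : e' <= hi q - lo q by by rewrite ge_min lexx orbT.
pose lo' i := if (i == q) && (s == lo q) then lo i + e' else lo i.
pose hi' i := if (i == q) && (s != lo q) then hi i - e' else hi i.
apply: (short_cover_sub R n (thickening R n X e `|` box R n lo' hi')%classic).
  move=> y [Xy|ybox].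
    by left; exists y => // i; rewrite subrr normr0 ltW.
  (* A point within [e'] of the facet is compared with its projection onto the facet, which lies in
     [X]. *)
  have [near|far] := leP `|y 0 q - s| e'.
    left; exists (\row_j if j == q then s else y 0 j).
      apply: Xs; last by rewrite mxE eqxx.
      move=> i; rewrite mxE; case: eqP => [->|_]; last exact: ybox.
      by have := lohi q; case: sE => ->; lra.
    move=> i; rewrite mxE; case: eqP => [->|_]; first exact: le_trans e'_le.
    by rewrite subrr normr0 ltW.
  right=> i; have := ybox i; rewrite /lo' /hi'.
  case: (eqVneq i q) => [->|_] //= yq.
  move: far; rewrite lter_normr => /orP; case: eqP => [->|ns] /=; first by lra.
  by case: sE => // ->; lra.
apply: short_coverU covX _.
have widths i : hi' i - lo' i = hi i - lo i - (if i == q then e' else 0).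
  rewrite /lo' /hi'; case: (i == q); case: (s == lo q) => /=; lra.
apply: (@short_cover_grid_lt R n lo' hi' c m q) => // [i|i|].
- rewrite -subr_ge0 widths; case: eqP => [->|_]; first by lra.
  by rewrite subr0 subr_ge0.
- by rewrite widths; have := side i; case: eqP => _; lra.
- by rewrite widths eqxx; have := side q; lra.
Qed.

(** * One face, grown from a small cube *)

(** The total of cell sides on a face is the borderline value, so every grid on a face has to gain
    strictness in some direction. *)
Lemma sum_outside (R : realType) (n : nat) (D : {set 'I_n}) :
  (2 < n)%N -> #|D| = 2 ->
  \sum_i (if i \in D then 0 else (n - 2)%:R^-1 : R) = 1.
Proof.
move=> n_gt2 cardD; rewrite (eq_bigr (fun i =>
  if i \in ~: D then (n - 2)%:R^-1 else 0)); last first.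
  by move=> i _; rewrite inE; case: ifP.
rewrite -big_mkcond /= sumr_const cardsCs finset.setCK cardD card_ord.
by rewrite -(mulr_natr _^-1) mulVf // pnatr_eq0 subn_eq0 -ltnNge.
Qed.

Lemma prod_outside (n k : nat) (D : {set 'I_n}) :
  #|D| = 2 -> (\prod_i (if i \in D then 1 else k) = k ^ (n - 2))%N.
Proof.
move=> cardD; rewrite (eq_bigr (fun i =>
  if i \in ~: D then k else 1%N)); last first.
  by move=> i _; rewrite inE; case: ifP.
by rewrite -big_mkcond /= prod_nat_const cardsCs finset.setCK cardD card_ord.
Qed.

(* The directions in D are fixed; those in A have been extended from side
   1 / (n - 2) to side 1, one at a time. *)
Lemma short_cover_partial_face (R : realType) (n : nat) (D A : {set 'I_n}) :
  (3 < n)%N -> #|D| = 2 -> A \subset ~: D ->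
  short_cover R n
    (box R n (fun=> 0) (fun i => if i \in D then 0 else
                                 if i \in A then 1 else (n - 2)%:R^-1))
    ((n - 2) ^ #|A| + 1).
Proof.
move=> n_gt3 cardD; have n_gt2 := ltnW n_gt3.
set k := (n - 2)%N.
have k_gt1 : (1 < k)%N by rewrite ltn_subRL.
have kR : 0 < k%:R :> R by rewrite ltr0n ltnW.
have kV : 0 < k%:R^-1 :> R by rewrite invr_gt0.
have kK : k%:R * k%:R^-1 = 1 :> R by rewrite mulfV ?gt_eqF.
have kV1 : k%:R^-1 < 1 :> R by rewrite invf_lt1 // ltr1n.
have sumc := sum_outside R n D n_gt2 cardD.
elim: {A}_.+1 {-2}A (ltnSn #|A|) => // d IHd A Ad AD.
have [A0|[q qA]] := set_0Vmem A.
  have [q qD] : exists q, q \in ~: D.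
    apply/set0Pn; rewrite -card_gt0 cardsCs finset.setCK cardD card_ord.
    by rewrite subn_gt0.
  rewrite inE in qD.
  pose hi0 (i : 'I_n) : R := if i \in D then 0 else k%:R^-1.
  (* The facet of the small cube where coordinate [q] is 0 has side sum [1 - 1/k] and is a single
     box; one more box then completes the cube. *)
  have -> : (k ^ #|A| + 1 = \prod_(i < n) 1 + \prod_(i < n) 1)%N.
    by rewrite A0 cards0 expn0 !big1.
  apply: (@short_cover_sub R n
    (box R n (fun=> 0%R) (fun i => if i == q then 0 else hi0 i)
     `|` box R n (fun=> 0%R) hi0)%classic).
    by move=> x xb; right=> i; have := xb i; rewrite A0 /hi0 inE.
  have hi0_ge0 i : 0 <= hi0 i by rewrite /hi0; case: ifP => // _; exact: ltW.
  apply: (@short_cover_step R n _ _ _ _ hi0 (fun=> 1%N) q 0) => //.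
  - apply: (@short_cover_grid_lt R n _ _ hi0 _ q) => // [i|i||].
    + by case: ifP.
    + by have := hi0_ge0 i; case: ifP; lra.
    + by rewrite eqxx /hi0 (negPf qD); lra.
    + by rewrite sumc.
  - by move=> i; lra.
  - by rewrite sumc.
  - by rewrite /hi0 (negPf qD).
  - by left.
  - move=> y yb yq i; have := yb i; case: eqP => // -> _.
    by rewrite yq lexx.
have qD : q \notin D by have := fintype.subsetP AD _ qA; rewrite inE.
have cardA : #|A| = #|A :\ q|.+1 by rewrite (cardsD1 q) qA.
have lt_d : (#|A :\ q| < d)%N by rewrite cardA in Ad.
have IH := IHd _ lt_d (fintype.subset_trans (subD1set _ _) AD).
(* The part from [1/k] to 1 in direction [q] has [k - 1] layers, and its facet at [1/k] is covered
   by induction. With [a = #|A|], its [(k - 1) * k ^ (a - 1)] boxes raise [k ^ (a - 1) + 1] to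
   [k ^ a + 1]. *)
pose m i := if i == q then k.-1 else if i \in A :\ q then k else 1%N.
have prodm : (\prod_i m i = k.-1 * k ^ #|A :\ q|)%N.
  rewrite (bigD1 q) //= {1}/m eqxx; congr (_ * _)%N.
  rewrite -prod_nat_const big_mkcond [in RHS]big_mkcond /=; apply: eq_bigr => i _.
  by rewrite /m !inE; case: eqP.
have -> : (k ^ #|A| + 1 = k ^ #|A :\ q| + 1 + \prod_i m i)%N.
  by rewrite prodm cardA expnS; nia.
pose hi (i : 'I_n) : R :=
  if i \in D then 0 else if i \in A then 1 else k%:R^-1.
pose lo (i : 'I_n) : R := if i == q then k%:R^-1 else 0.
apply: (@short_cover_sub R n _ _ _ _
  (@short_cover_step R n _ _ lo hi
    (fun i => if i \in D then 0 else k%:R^-1) m q k%:R^-1 IH _ _ _ _ _ _ _)).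
- move=> x xb; have [xq|xq] := leP (x 0 q) k%:R^-1.
    left=> i; have := xb i; rewrite !inE.
    by case: eqP => [->|] //=; rewrite (negPf qD); lra.
  right=> i; have := xb i; rewrite /lo /hi.
  by case: eqP => [->|] //=; rewrite (negPf qD) qA; lra.
- move=> i; rewrite /lo /hi; case: eqP => [->|_].
    by rewrite (negPf qD) qA ltW.
  by case: ifP => // _; case: ifP => // _; exact: ltW.
- move=> i; rewrite /m; case: ifP => _; first by lia.
  by case: ifP => // _; lia.
- move=> i; rewrite /lo /hi /m !inE; case: eqP => [->|_] /=.
    rewrite (negPf qD) qA -subn1 (natrB _ (ltnW k_gt1)).
    by rewrite mulrBl kK mul1r.
  case: ifP => [_|_]; first by rewrite mulr0 subr0.
  by case: ifP => _; rewrite subr0 ?kK ?mul1r.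
- by rewrite sumc.
- by rewrite /lo /hi eqxx (negPf qD) qA.
- by left; rewrite /lo eqxx.
- move=> y yb yq i; have := yb i; rewrite /lo /hi !inE.
  case: eqP => [->|_] //=.
  by rewrite (negPf qD) yq lexx (ltW kV).
Qed.

(** * Coding and counting the faces *)

(* The faces of codimension 2 are coded by sets of two facets (i, b), the facet
   (i, b) being the one where x 0 i = b. *)
Definition face (R : realType) (n : nat) (f : {set 'I_n * bool}) :
    set 'rV[R]_n :=
  [set x | unit_cube x /\ forall u, u \in f -> x 0 u.1 = u.2%:R]%classic.

(** The removed pairs consist of opposite facets, which do not meet. *)
Definition faces (n : nat) : {set {set 'I_n * bool}} :=
  [set f : {set 'I_n * bool} | #|f| == 2]
    :\: [set [set (i, false); (i, true)] | i : 'I_n].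

(** Of the [n * (2 * n - 1)] pairs of facets, [n] are opposite. *)
Lemma card_faces (n : nat) : #|faces n| = (2 * n * (n - 1))%N.
Proof.
rewrite /faces cardsD card_draws card_prod card_ord card_bool.
rewrite (finset.setIidPr _); last first.
  apply/fintype.subsetP => _ /imsetP[i _ ->]; rewrite inE cards2.
  by rewrite xpair_eqE eqxx.
rewrite card_imset ?card_ord ?bin2; last first.
  move=> i j /setP/(_ (i, true)).
  by rewrite !inE !xpair_eqE !eqxx /= !andbF andbT => /esym/eqP.
by case: n => [|n]; nia.
Qed.

Lemma facesP (n : nat) (f : {set 'I_n * bool}) :
  reflect (exists2 u, u \in f & exists2 v, u.1 != v.1 & f = [set u; v])
          (f \in faces n).
Proof.
apply: (iffP idP) => [|[u _ [v uv ->]]].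
  rewrite !inE => /andP[/imsetP nf /cards2P[u [v [uv fE]]]].
  exists u; first by rewrite fE !inE eqxx.
  exists v => //; apply/eqP => uv1; apply: nf.
  exists u.1; rewrite // fE.
  move: u v uv uv1 {fE} => [i b] [j c] /= + ij; rewrite -{j}ij.
  by case: b; case: c; rewrite ?eqxx // 1?finset.setUC.
rewrite !inE cards2; apply/andP; split.
  apply/imsetP => -[i _ fE].
  have : u \in [set (i, false); (i, true)] by rewrite -fE !inE eqxx.
  have : v \in [set (i, false); (i, true)] by rewrite -fE !inE eqxx orbT.
  rewrite !inE => /orP vi /orP ui; move/negP: uv; apply.
  by case: vi => /eqP->; case: ui => /eqP->.
by case: (eqVneq u v) uv => [->|]; rewrite ?eqxx.
Qed.

(** * Covering the first face and an adjacent face *)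

(** This is the partial face with all free directions extended; the fixed coordinates are 0 because
    partial faces grow from the origin. *)
Lemma short_cover_first_face (R : realType) (n : nat) (p q : 'I_n) :
  (3 < n)%N -> p != q ->
  short_cover R n (face R n [set (p, false); (q, false)])
    ((n - 2) ^ (n - 2) + 1).
Proof.
move=> n_gt3 pq; set D := [set p; q].
have cardD : #|D| = 2 by rewrite cards2 pq.
have cardC : #|~: D| = (n - 2)%N by rewrite cardsCs finset.setCK cardD card_ord.
have := short_cover_partial_face R n D (~: D) n_gt3 cardD (subxx _).
rewrite cardC; apply: short_cover_sub.
move=> x [xcube xf] i; rewrite finset.in_setC.
case: (boolP (i \in D)) => [|_] /=; last exact: xcube.
rewrite !inE => /orP iD.
have -> : x 0 i = 0.
  by case: iD => /eqP->; [apply: (xf (p, false))|apply: (xf (q, false))];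
     rewrite !inE eqxx ?orbT.
by rewrite lexx.
Qed.

(** The points of the new face with coordinate [w.1] equal to [w.2] form one of its facets and lie
    in the face of [u] and [w], hence in [X]. So [short_cover_step] applies in direction [w.1]. *)
Lemma short_cover_adjacent_face (R : realType) (n N : nat)
    (X : set 'rV[R]_n) (u v w : 'I_n * bool) :
  (2 < n)%N -> u.1 != v.1 -> w.1 \notin [set u.1; v.1] ->
  (face R n [set u; w] `<=` X)%classic -> short_cover R n X N ->
  short_cover R n (X `|` face R n [set u; v])%classic (N + (n - 2) ^ (n - 2)).
Proof.
move=> n_gt2 uv wD faceX covX; set D := [set u.1; v.1] in wD *.
have cardD : #|D| = 2 by rewrite cards2 uv.
have k_gt0 : (0 < n - 2)%N by rewrite subn_gt0.
(* [side i 0] and [side i 1] are the ends of the face in direction [i]; they coincide in the two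
   fixed directions. *)
pose side (i : 'I_n) (a : R) : R :=
  if i == u.1 then u.2%:R else if i == v.1 then v.2%:R else a.
have bit (b : bool) : (0 : R) <= b%:R <= 1 by case: b; rewrite ?lexx ?ler01.
have side_in i a : 0 <= a <= 1 -> 0 <= side i a <= 1.
  by move=> a01; rewrite /side; do 2?case: ifP => _ //; exact: bit.
have sideD i a b : i \in D -> side i a = side i b.
  by rewrite /side !inE; do 2?case: ifP.
have sideND i a : i \notin D -> side i a = a.
  by rewrite /side !inE; do 2?case: ifP.
have side_u a : side u.1 a = u.2%:R by rewrite /side eqxx.
have side_v a : side v.1 a = v.2%:R.
  by rewrite /side eq_sym (negPf uv) eqxx.
rewrite -(prod_outside n (n - 2) D cardD).
apply: (@short_cover_sub R n
  (X `|` box R n (side^~ 0) (side^~ 1))%classic).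
  move=> x [Xx|[xcube xf]]; first by left.
  right=> i; have := xcube i; rewrite /side.
  case: eqP => [->|_]; first by rewrite (xf u) ?lexx // !inE eqxx.
  by case: eqP => [->|_] //; rewrite (xf v) ?lexx // !inE eqxx orbT.
apply: (@short_cover_step R n _ _ _ _
  (fun i => if i \in D then 0 else (n - 2)%:R^-1) _ w.1 w.2%:R) => //.
- by move=> i; rewrite /side; do 2?case: ifP.
- by move=> i; case: ifP.
- move=> i; case: ifP => iD.
    by rewrite mulr0 (sideD i 1 0 iD) subrr.
  by rewrite !sideND ?iD // subr0 mulfV // pnatr_eq0 -lt0n.
- by rewrite sum_outside.
- by rewrite !sideND.
- by rewrite !sideND //; case: w.2; [right|left].
- move=> y yb yw; apply: faceX; split=> [i|z].
    have := yb i; have := side_in i 0; have := side_in i 1.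
    rewrite !lexx !ler01 /= => /(_ isT) h1 /(_ isT) h0; lra.
  rewrite !inE => /orP[] /eqP-> //.
  by have := yb u.1; rewrite !side_u => /andP[a b]; apply/eqP; rewrite eq_le a b.
Qed.

(** * Reaching all faces by adjacency *)

(* Faces sharing a facet (u, say) and otherwise in distinct directions meet in
   a face of codimension 3; this adjacency connects all codimension 2 faces. *)
Lemma faces_connected (n : nat) (S : {set {set 'I_n * bool}}) (p q : 'I_n) :
  (2 < n)%N -> p != q -> [set (p, false); (q, false)] \in S ->
  (forall u v w, u.1 != v.1 -> w.1 \notin [set u.1; v.1] ->
     [set u; w] \in S -> [set u; v] \in S) ->
  faces n \subset S.
Proof.
move=> n_gt2 pq S0 closed.
have third (i j : 'I_n) : exists r : 'I_n, r \notin [set i; j].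
  have : (0 < #|~: [set i; j]|)%N.
    rewrite cardsCs finset.setCK card_ord subn_gt0.
    by apply: leq_ltn_trans n_gt2; rewrite cards2; case: eqP.
  by rewrite card_gt0 => /set0Pn[r]; rewrite inE; exists r.
(* Only the second facet of the starting pair is exchanged. If [v] has direction [q], a detour
   through a third direction [r] is taken, as [closed] requires [w] to differ in direction from
   [v]. *)
have star v : v.1 != p -> [set (p, false); v] \in S.
  move=> vp; have [vq|vq] := eqVneq v.1 q; last first.
    apply: (closed (p, false) v (q, false)) => //=; first by rewrite eq_sym.
    by rewrite !inE negb_or eq_sym pq eq_sym.
  have [r] := third p q; rewrite !inE negb_or => /andP[rp rq].
  apply: (closed (p, false) v (r, false)) => /=; first by rewrite eq_sym.
    by rewrite !inE negb_or rp vq.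
  apply: (closed (p, false) (r, false) (q, false)) => //=.
    by rewrite eq_sym.
  by rewrite !inE negb_or eq_sym pq eq_sym.
have off u v : u.1 != p -> v.1 != p -> u.1 != v.1 -> [set u; v] \in S.
  move=> up vp uv; apply: (closed u v (p, false)) => //=.
    by rewrite !inE negb_or eq_sym up eq_sym.
  by rewrite finset.setUC star.
(* What [star] and [off] leave out are the pairs with [(p, true)]; they are reached from a pair
   avoiding direction [p]. *)
have at_p u v : u.1 != p -> u.1 != v.1 -> [set u; v] \in S.
  move=> up uv; have [vp|vp] := eqVneq v.1 p; last exact: off.
  have [r] := third p u.1; rewrite !inE negb_or => /andP[rp ru].
  apply: (closed u v (r, false)) => //=.
    by rewrite !inE negb_or ru vp.
  by apply: off; rewrite //= eq_sym.
apply/fintype.subsetP => f /facesP[u _ [v uv ->]].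
have [up|up] := eqVneq u.1 p; last exact: at_p.
by rewrite finset.setUC; apply: at_p; rewrite 1?eq_sym // -up.
Qed.

(** Each face after the first adds [(n - 2) ^ (n - 2)] boxes, so the extra box of the first face is
    the only one in the count. *)
Lemma short_cover_faces (R : realType) (n : nat) :
  (3 < n)%N ->
  short_cover R n (\bigcup_(f in [set` faces n]) face R n f)%classic
    (#|faces n| * (n - 2) ^ (n - 2) + 1).
Proof.
move=> n_gt3; have n_gt2 := ltnW n_gt3.
pose p := Ordinal (ltnW (ltnW n_gt2)); pose q := Ordinal (ltnW n_gt2).
have pq : p != q by [].
pose f0 := [set (p, false); (q, false)].
pose good (S : {set {set 'I_n * bool}}) := short_cover R n
  (\bigcup_(f in [set` S]) face R n f)%classic
  (#|S| * (n - 2) ^ (n - 2) + 1).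
have good0 : good [set f0].
  rewrite /good cards1 mul1n.
  apply: short_cover_sub (short_cover_first_face R n p q n_gt3 pq).
  by move=> x [f /=]; rewrite !inE => /eqP->.
have grow d (S : {set {set 'I_n * bool}}) : (#|faces n :\: S| <= d)%N ->
    f0 \in S -> S \subset faces n -> good S -> good (faces n).
  elim: d S => [|d IHd] S cardS S0 Sfaces goodS.
    suff -> : faces n = S by [].
    apply/eqP; rewrite finset.eqEsubset Sfaces andbT -finset.setD_eq0.
    by rewrite -cards_eq0 -leqn0.
  (* Either some missing face is adjacent to one in [S] and can be added, or [S] is closed under
     adjacency and already contains all faces. *)
  have [[u [v [w [uv wuv Suw Suv]]]]|closed] := pselect (exists u v w,
      [/\ u.1 != v.1, w.1 \notin [set u.1; v.1],
          [set u; w] \in S & [set u; v] \notin S]); last first.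
    apply: (IHd S) => //.
    suff : faces n \subset S.
      by rewrite -finset.setD_eq0 => /eqP->; rewrite cards0.
    apply: (faces_connected n S p q) => // u v w uv wuv Suw.
    by apply: contrapT => /negP Suv; apply: closed; exists u, v, w.
  have uv_face : [set u; v] \in faces n.
    apply/facesP; exists u; first by rewrite !inE eqxx.
    by exists v.
  apply: (IHd ([set u; v] |: S)).
  - have : (#|faces n :\: ([set u; v] |: S)| < #|faces n :\: S|)%N.
      apply: proper_card; apply/properP; split.
        by apply: finset.setDS; exact: finset.subsetUr.
      by exists [set u; v]; rewrite finset.in_setD ?Suv ?uv_face // setU11.
    by move=> lt; rewrite -ltnS; exact: leq_trans cardS.
  - by rewrite inE S0 orbT.
  - by rewrite finset.subUset finset.sub1set uv_face.
  - rewrite /good cardsU1 Suv mulnDl mul1n -addnA.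
    have sub_uw : (face R n [set u; w] `<=`
        \bigcup_(f in [set` S]) face R n f)%classic.
      by move=> x xf; exists [set u; w].
    have := short_cover_adjacent_face R n _ _ u v w n_gt2 uv wuv sub_uw goodS.
    rewrite addnC; apply: short_cover_sub.
    move=> x [f /=]; rewrite !inE => /orP[/eqP->|fS] xf; first by right.
    by left; exists f.
have f0_face : f0 \in faces n.
  apply/facesP; exists (p, false); first by rewrite !inE eqxx.
  by exists (q, false).
by apply: (grow #|faces n :\: [set f0]| [set f0]);
   rewrite ?leqnn ?set11 ?finset.sub1set.
Qed.

(** * From faces to the covering number *)

Lemma skeleton_sub_faces (R : realType) (n : nat) :
  (1 < n)%N ->
  (@skeleton R (n - 2) n `<=` \bigcup_(f in [set` faces n]) face R n f)%classic.
Proof.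
move=> n_gt1 x [F [b [cardF [xcube xF]]]].
have /eqP/cards2P[p [q [pq FE]]] : #|~: F| = 2.
  by rewrite cardsCs finset.setCK card_ord cardF subKn.
exists [set (p, b p); (q, b q)].
  apply/facesP; exists (p, b p); first by rewrite !inE eqxx.
  by exists (q, b q).
split=> // u; rewrite !inE => /orP[] /eqP-> /=; apply: xF.
  by rewrite -finset.in_setC FE !inE eqxx.
by rewrite -finset.in_setC FE !inE eqxx orbT.
Qed.

Lemma short_cover_covered_by (R : realType) (n : nat) (X : set 'rV[R]_n)
    (N : nat) :
  short_cover R n X N -> covered_by X (@short_boxes R n) N.
Proof.
move=> [lo [hi [short cov]]]; exists (fun j => box R n (lo j) (hi j)).
split=> [j|x /cov[j xj]]; last by exists j.
exists (box R n (lo j) (hi j)); last first.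
  exists 0; apply/seteqP; split=> x.
    by exists x; rewrite // addr0.
  by move=> [y yj <-]; rewrite addr0.
have [lohi sumj] := short j.
exists (\row_i lo j i), (\row_i (hi j i - lo j i)); split.
- by move=> i; rewrite mxE subr_ge0.
- by under eq_bigr => i _ do rewrite mxE.
- by apply/seteqP; split=> x xj i; have := xj i; rewrite !mxE addrC subrK.
Qed.

Lemma short_cover_unit_pairs (R : realType) (n : nat) (A : set 'rV[R]_n) :
  @unit_pairs R n A -> short_cover R n A (2 * n).
Proof.
move=> [x _ ->].
have -> : (2 * n = #|{: 'I_n * bool}|)%N.
  by rewrite card_prod card_ord card_bool mulnC.
apply: (short_cover_sub R n _ _ _ _ (short_cover_points R n _
  (fun u : 'I_n * bool => if u.2 then x u.1 + delta_mx 0 u.1 else x u.1))).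
by move=> y [i _ [->|->]]; [exists (i, false)|exists (i, true)].
Qed.

Theorem proposition1p1 (R : realType) (n : nat) (hn : (5 <= n)%N) :
  (sup_covering R n <=
     ((2 * n * (n - 1) * (n - 2) ^ (n - 2) + 2 * n + 1)%N%:R : R)%:E)%E.
Proof.
have n_gt3 : (3 < n)%N by exact: ltnW.
apply: ge_ereal_sup => _ [A Apairs <-].
apply: ereal_inf_lbound.
exists (2 * n * (n - 1) * (n - 2) ^ (n - 2) + 2 * n + 1)%N => //.
apply: short_cover_covered_by.
(* The total is regrouped as [2 * n] boxes for [A] plus the count for the faces. *)
rewrite -card_faces -addnA addnCA.
apply: short_coverU; first exact: short_cover_unit_pairs.
apply: short_cover_sub (short_cover_faces R n n_gt3).
by apply: skeleton_sub_faces; exact: ltnW (ltnW _).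
Qed.
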